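(* Let $\alpha>0$ and let $f:\mathbb{R}^n\to\mathbb{R}$ be a smooth function with minimum value $f^*$ such that, for constants $\ell_f,L_f\ge0$ and $\mu_f>0$ and all $x\in\mathbb{R}^n$, $$-\ell_f I_n\preceq\nabla^2 f(x)\preceq L_f I_n,\qquad \tfrac12\|\nabla f(x)\|^2\ge\mu_f\,(f(x)-f^* ).$$ Let the scalars $\underline{u}_{\mathbf{II}},\overline{u}_{\mathbf{II}},\beta_{\mathbf{II}}$ satisfy $$\underline{u}_{\mathbf{II}}<-\ell_f\beta_{\mathbf{II}}^2+(1-\alpha)\beta_{\mathbf{II}},\qquad \overline{u}_{\mathbf{II}}>L_f\beta_{\mathbf{II}}^2+(1-\alpha)\beta_{\mathbf{II}},\qquad \alpha\le2\mu_f\beta_{\mathbf{II}},$$ and consider the structure-$\mathbf{II}$ hybrid control system (defined in the context). Given the initial condition $\big(x_1(0),-\beta_{\mathbf{II}}\nabla f(x_1(0))\big)$, the time between two consecutive jumps of the solution trajectory, denoted by $\tau_{\mathbf{II}}$ (the time elapsed from the state $\big(x_1(0),-\beta_{\mathbf{II}}\nabla f(x_1(0))\big)$ until the next jump), satisfies, for any scalar $r\in(0,1)$, $$\tau_{\mathbf{II}}\ge\min\big\{r\,\omega^{-1},\ \delta\,(b_1+b_2)^{-1}\big\},$$ where $$\delta:=\min\big\{\overline{u}_{\mathbf{II}}-(L_f\beta_{\mathbf{II}}^2+(1-\alpha)\beta_{\mathbf{II}}),\ (-\ell_f\beta_{\mathbf{II}}^2+(1-\alpha)\beta_{\mathbf{II}})-\underline{u}_{\mathbf{II}}\big\},$$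 $$U:=\max\{\overline{u}_{\mathbf{II}},-\underline{u}_{\mathbf{II}}\},\qquad \mathcal{L}_f:=\max\{\ell_f,L_f\},\qquad \omega:=\mathcal{L}_f(\beta_{\mathbf{II}}^2+\beta_{\mathbf{II}}U)^{1/2},$$ $$b_1:=\frac{2\mathcal{L}_f\beta_{\mathbf{II}}\big(U+\omega(\beta_{\mathbf{II}}+U)\big)}{(1-r)^3},\qquad b_2:=|\alpha-1|\frac{2\omega\beta_{\mathbf{II}}}{(1-r)^3}+|\alpha-1|\,\alpha\,\beta_{\mathbf{II}}(1+r).$$ Thus, the solution trajectories are Zeno-free.
   Context: Smooth means (at least) twice differentiable; $\|\cdot\|$ is the Euclidean norm. Structure-$\mathbf{II}$ hybrid control system: the state is $x=(x_1,x_2)\in\mathbb{R}^n\times\mathbb{R}^n$. The feedback law is $$u_{\mathbf{II}}(x)=\frac{\langle\nabla^2 f(x_1)x_2,x_2\rangle+(1-\alpha)\langle\nabla f(x_1),-x_2\rangle}{\|\nabla f(x_1)\|^2}$$ (defined where $\nabla f(x_1)\ne0$). The flow set is $\mathcal{C}_{\mathbf{II}}=\{x\in\mathbb{R}^{2n}:u_{\mathbf{II}}(x)\in[\underline{u}_{\mathbf{II}},\overline{u}_{\mathbf{II}}]\}$. While in the flow set, the state evolves continuously according to $$\dot x_1=x_2,\qquad \dot x_2=-x_2-u_{\mathbf{II}}(x)\nabla f(x_1).$$ As soon as the state reaches the boundary of $\mathcal{C}_{\mathbf{II}}$ (otherwise than as an interior point of the flow set), it is instantaneously reset (a jump) by $x^+=G_{\mathbf{II}}(x)=(x_1,\,-\beta_{\mathbf{II}}\nabla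 f(x_1))$, after which it flows again. A solution trajectory is called Zeno-free if the number of jumps within any finite time interval is bounded. *)

(* Defs.v *)
From HB Require Import structures.
From mathcomp Require Import all_boot all_order all_algebra.
From mathcomp Require Import all_classical all_reals all_analysis.

Set Implicit Arguments.
Unset Strict Implicit.
Unset Printing Implicit Defensive.

Import Order.TTheory GRing.Theory Num.Theory.
Import numFieldNormedType.Exports.
Local Open Scope classical_set_scope.
Local Open Scope ring_scope.

(* The norm that the library puts on 'rV[R]_n is the sup norm, hence a separate
   Euclidean norm; the two norms induce the same topology and the same notion
   of (Frechet) differentiability. *)

Definition dotv (R : realType) (n : nat) (u v : 'rV[R]_n) : R :=
  \sum_(i < n) u 0 i * v 0 i.

Definition enorm (R : realType) (n : nat) (v : 'rV[R]_n) : R :=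
  Num.sqrt (dotv v v).

Definition grad (R : realType) (n : nat) (f : 'rV[R]_n -> R) (x : 'rV[R]_n)
    : 'rV[R]_n :=
  \row_(i < n) 'D_(delta_mx 0 i) f x.

(* The library's Jacobian acts on row vectors from the right, so entry (i, j)
   is the i-th partial derivative of the j-th component of the gradient, and
   v *m hess f x is the derivative of the gradient at x in direction v. *)
Definition hess (R : realType) (n : nat) (f : 'rV[R]_n -> R) (x : 'rV[R]_n)
    : 'M[R]_n :=
  jacobian (grad f) x.

Definition twice_differentiable (R : realType) (n : nat)
    (f : 'rV[R]_n -> R) : Prop :=
  (forall x, differentiable f x) /\ (forall x, differentiable (grad f) x).

Definition psd_mx (R : realType) (n : nat) (A : 'M[R]_n) : Prop :=
  forall v : 'rV[R]_n, 0 <= dotv (v *m A) v.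

Definition loewner_le (R : realType) (n : nat) (A B : 'M[R]_n) : Prop :=
  psd_mx (B - A).

Definition is_minimum_value (R : realType) (n : nat)
    (f : 'rV[R]_n -> R) (m : R) : Prop :=
  (exists x, f x = m) /\ (forall x, m <= f x).

(* At a critical point of f the value below is the junk value 0; the flow set
   and the solutions are therefore restricted to in_domain. *)
Definition u_II (R : realType) (n : nat) (f : 'rV[R]_n -> R) (alpha : R)
    (x : 'rV[R]_n * 'rV[R]_n) : R :=
  (dotv (x.2 *m hess f x.1) x.2 + (1 - alpha) * dotv (grad f x.1) (- x.2))
  / enorm (grad f x.1) ^+ 2.

Definition in_domain (R : realType) (n : nat) (f : 'rV[R]_n -> R)
    (x : 'rV[R]_n * 'rV[R]_n) : Prop :=
  grad f x.1 <> 0.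

Definition C_II (R : realType) (n : nat) (f : 'rV[R]_n -> R)
    (alpha ulo uhi : R) : set ('rV[R]_n * 'rV[R]_n) :=
  [set x | in_domain f x /\ ulo <= u_II f alpha x <= uhi].

Definition G_II (R : realType) (n : nat) (f : 'rV[R]_n -> R) (beta : R)
    (x : 'rV[R]_n * 'rV[R]_n) : 'rV[R]_n * 'rV[R]_n :=
  (x.1, - (beta *: grad f x.1)).

Definition boundary (T : topologicalType) (A : set T) : set T :=
  closure A `\` interior A.

(* Hybrid time domains in the sense of Goebel, Sanfelice and Teel: a set of
   pairs (time, number of jumps so far), here indexed by the number of jumps,
   all of whose truncations have the form
   [t_0, t_1] x {0} u ... u [t_J, t_(J+1)] x {J} with
   0 = t_0 <= ... <= t_(J+1).
   Equal t_j are allowed, and jump times may accumulate, so Zeno behaviour is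
   not excluded. *)
Definition hybrid_time_domain (R : realType) (E : nat -> set R) : Prop :=
  [/\ E 0%N 0,
      forall j s, E j s -> 0 <= s
    & forall J S, E J S ->
        exists t : nat -> R,
          [/\ t 0%N = 0,
              forall j, (j <= J)%N -> t j <= t j.+1
            & forall j, (j <= J)%N ->
                E j `&` [set s | s <= S] = [set s | t j <= s <= t j.+1]]].

Definition jump_at (R : realType) (E : nat -> set R) (j : nat) (s : R) : Prop :=
  E j s /\ E j.+1 s.

(* phi j s is the state at time s after j jumps. *)
Record hybrid_solution_II (R : realType) (n : nat) (f : 'rV[R]_n -> R)
    (alpha beta ulo uhi : R)
    (E : nat -> set R) (phi : nat -> R -> 'rV[R]_n * 'rV[R]_n) : Prop :=
  HybridSolutionII {
    sol_time_domain : hybrid_time_domain E ;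
    sol_in_domain : forall j s, E j s -> in_domain f (phi j s) ;
    sol_continuous : forall j, {within E j, continuous (phi j)} ;
    sol_flow_set : forall j s, interior (E j) s ->
      C_II f alpha ulo uhi (phi j s) ;
    sol_flow_x1 : forall j s, interior (E j) s ->
      is_derive s 1 (fun t : R => (phi j t).1) (phi j s).2 ;
    sol_flow_x2 : forall j s, interior (E j) s ->
      is_derive s 1 (fun t : R => (phi j t).2)
        (- (phi j s).2 - u_II f alpha (phi j s) *: grad f (phi j s).1) ;
    sol_forced_jump : forall j s s', E j s ->
      boundary (C_II f alpha ulo uhi) (phi j s) -> s < s' -> ~ E j s' ;
    sol_jump : forall j s, jump_at E j s ->
      boundary (C_II f alpha ulo uhi) (phi j s) /\
      phi j.+1 s = G_II f beta (phi j s) }.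

Definition zeno_free (R : realType) (E : nat -> set R) : Prop :=
  forall a b : R, finite_set [set j | exists2 s, a <= s <= b & jump_at E j s].

(* Main.v *)
Require Import Defs.
From HB Require Import structures.
From mathcomp Require Import all_boot all_order all_algebra.
From mathcomp Require Import all_classical all_reals all_analysis.
From mathcomp Require Import ring lra.

(* Write g for the gradient along the flow, g0 for its value at the start and
   sigma = <g, x2>. The feedback cancels the Hessian term of sigma', so
   sigma' = - alpha sigma and sigma = - beta |g0|^2 exp(- alpha t). With this,
   |x2|^2 obeys a linear differential inequality, which bounds the speed by
   |g0| sqrt(beta^2 + beta U); since the gradient is Lipschitz with constant
   max(lf, Lf), |g - g0| <= omega t |g0|. Hence for t < r / omega the ratios
   |x2|^2 / |g|^2 and - sigma / |g|^2 stay within O(t) of their initial values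
   beta^2 and beta, and u_II stays strictly between its bounds for
   t < delta / (b1 + b2). The estimates only use the Hessian through its
   quadratic-form bounds, so they hold in a neighbourhood of the state: it is in
   the interior of the flow set, and cannot jump. *)

Set Implicit Arguments.
Unset Strict Implicit.
Unset Printing Implicit Defensive.

Import Order.TTheory GRing.Theory Num.Theory.
Import numFieldNormedType.Exports.
Local Open Scope classical_set_scope.
Local Open Scope ring_scope.

(** * Euclidean inner product and norm *)

Section Euclidean.
Context {R : realType} {n : nat}.
Implicit Types u v w : 'rV[R]_n.

Lemma dotvC u v : dotv u v = dotv v u.
Proof. by apply: eq_bigr => i _; rewrite mulrC. Qed.

Lemma dotvDl u v w : dotv (u + v) w = dotv u w + dotv v w.
Proof. by rewrite -big_split; apply: eq_bigr => i _; rewrite mxE mulrDl. Qed.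

Lemma dotvZl (k : R) u v : dotv (k *: u) v = k * dotv u v.
Proof. by rewrite mulr_sumr; apply: eq_bigr => i _; rewrite mxE mulrA. Qed.

Lemma dotvDr u v w : dotv u (v + w) = dotv u v + dotv u w.
Proof. by rewrite !(dotvC u) dotvDl. Qed.

Lemma dotvZr (k : R) u v : dotv u (k *: v) = k * dotv u v.
Proof. by rewrite !(dotvC u) dotvZl. Qed.

Lemma dotvNl u v : dotv (- u) v = - dotv u v.
Proof. by rewrite -scaleN1r dotvZl mulN1r. Qed.

Lemma dotvNr u v : dotv u (- v) = - dotv u v.
Proof. by rewrite -scaleN1r dotvZr mulN1r. Qed.

Definition dotvE := (dotvDl, dotvDr, dotvNl, dotvNr, dotvZl, dotvZr).

Lemma dotv_ge0 u : 0 <= dotv u u.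
Proof. by apply: sumr_ge0 => i _; rewrite -expr2 sqr_ge0. Qed.

Lemma dotv_eq0 u : (dotv u u == 0) = (u == 0).
Proof.
apply/eqP/eqP => [|->]; last by rewrite /dotv big1// => i _; rewrite mxE mul0r.
move=> /eqP; rewrite /dotv psumr_eq0; last by move=> i _; rewrite -expr2 sqr_ge0.
move=> /allP u0; apply/rowP => i; rewrite mxE.
by have /eqP/eqP := u0 i (mem_index_enum i); rewrite mulf_eq0 orbb => /eqP.
Qed.

Lemma enorm_ge0 u : 0 <= enorm u.
Proof. exact: sqrtr_ge0. Qed.

Lemma sqr_enorm u : enorm u ^+ 2 = dotv u u.
Proof. by rewrite sqr_sqrtr// dotv_ge0. Qed.

Lemma enorm_gt0 u : (0 < enorm u) = (u != 0).
Proof. by rewrite sqrtr_gt0 lt_def dotv_ge0 andbT dotv_eq0. Qed.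

(** Cauchy-Schwarz: expand the squared norm of [u] minus its projection on [v] and clear the
    denominator [dotv v v]. *)
Lemma dotv_le_enorm u v : dotv u v <= enorm u * enorm v.
Proof.
have [->|v0] := eqVneq v 0.
  rewrite -(scale0r v) dotvZr mul0r mulr_ge0 ?enorm_ge0 //.
have vv : 0 < dotv v v by rewrite lt_def dotv_ge0 dotv_eq0 v0.
apply: (le_trans (ler_norm _)).
rewrite -ler_sqr ?nnegrE ?mulr_ge0 ?enorm_ge0// exprMn !sqr_enorm.
rewrite real_normK ?num_real//.
have := dotv_ge0 (u - (dotv u v / dotv v v) *: v).
rewrite !dotvE (dotvC v u) => h.
have := mulr_ge0 h (ltW vv).
set t := dotv u v / dotv v v.
have tE : t * dotv v v = dotv u v by rewrite divfK ?gt_eqF.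
nra.
Qed.

Lemma enormD_le u v : enorm (u + v) <= enorm u + enorm v.
Proof.
rewrite -ler_sqr ?nnegrE ?addr_ge0 ?enorm_ge0// sqr_enorm !dotvE (dotvC v u).
have := dotv_le_enorm u v; have := sqr_enorm u; have := sqr_enorm v; nra.
Qed.

Lemma enormN u : enorm (- u) = enorm u.
Proof. by rewrite /enorm dotvNl dotvNr opprK. Qed.

Lemma enormB_dist u v : `|enorm u - enorm v| <= enorm (u - v).
Proof.
have h1 := enormD_le (u - v) v; have h2 := enormD_le (- (u - v)) u.
move: h1 h2; rewrite enormN opprB subrK subrK => h1 h2.
by rewrite ler_norml; apply/andP; split; lra.
Qed.

(** Turns a vector bound into a scalar one, so that scalar mean value arguments apply to
    vector-valued curves. *)
Lemma enorm_le_dual u (M : R) :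
  dotv u u <= M * enorm u -> 0 <= M -> enorm u <= M.
Proof.
rewrite -sqr_enorm => h M0; have [->//|u0] := eqVneq (enorm u) 0.
by move: h; rewrite expr2 ler_pM2r// lt_def u0 enorm_ge0.
Qed.

End Euclidean.

(** * Derivatives along curves and one-sided Taylor estimates *)

Section Derivatives.
Context {R : realType}.

Lemma is_derive_dotv {n : nat} (c d : R -> 'rV[R]_n) (s : R) (c' d' : 'rV[R]_n) :
  is_derive s 1 c c' -> is_derive s 1 d d' ->
  is_derive s 1 (fun t => dotv (c t) (d t)) (dotv c' (d s) + dotv (c s) d').
Proof.
move=> dc dd.
have coord (e : R -> 'rV[R]_n) e' i :
    is_derive s 1 e e' -> is_derive s 1 (fun t => e t 0 i) (e' 0 i).
  move=> de; have ed : derivable e s 1 by [].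
  apply: DeriveDef; first by have /derivable_mxP := ed; apply.
  by have := derive_val (is_derive := de); rewrite derive_mx// => <-; rewrite mxE.
have -> : (fun t => dotv (c t) (d t)) =
    \sum_(i < n) ((fun t => c t 0 i) * (fun t => d t 0 i)).
  by apply/funext => t; rewrite fct_sumE.
rewrite /dotv -big_split.
apply: is_derive_sum => i.
have ? := coord _ _ i dc; have ? := coord _ _ i dd.
apply: is_derive_eq; rewrite /GRing.scale/=; ring.
Qed.

Lemma is_derive_diff_comp {V W : normedModType R} (F : V -> W) (c : R -> V)
    (s : R) (v : V) :
  differentiable F (c s) -> is_derive s 1 c v ->
  is_derive s 1 (F \o c) ('d F (c s) v).
Proof.
move=> dF dc; have dcs : differentiable c s by apply/derivable1_diffP.
have dFc : differentiable (F \o c) s by exact: differentiable_comp.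
apply: DeriveDef; first exact: diff_derivable.
by rewrite deriveE// diff_comp//= -(deriveE _ dcs) derive_val.
Qed.

Lemma diff_grad {n : nat} (f : 'rV[R]_n -> R) (x v : 'rV[R]_n) :
  differentiable f x -> 'd f x v = dotv (grad f x) v.
Proof.
move=> df; rewrite {1}(row_sum_delta v) linear_sum; apply: eq_bigr => i _.
by rewrite linearZ mxE deriveE// mulrC.
Qed.

Lemma is_derive_grad_comp {n : nat} (f : 'rV[R]_n -> R) (c : R -> 'rV[R]_n)
    (s : R) (v : 'rV[R]_n) :
  differentiable (grad f) (c s) -> is_derive s 1 c v ->
  is_derive s 1 (fun t => grad f (c t)) (v *m hess f (c s)).
Proof.
move=> dg dc; have -> : v *m hess f (c s) = 'd (grad f) (c s) v.
  by rewrite /hess /jacobian mul_rV_lin1.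
exact: is_derive_diff_comp.
Qed.

(** Derivatives are asked for only inside the interval, as the flow equations hold only in the
    interior of a flow arc. *)
Lemma increment_le (h dh : R -> R) (a b M : R) : a <= b ->
  (forall x, a < x < b -> is_derive x 1 h (dh x)) ->
  {within `[a, b], continuous h} ->
  (forall x, a < x < b -> dh x <= M) -> h b - h a <= M * (b - a).
Proof.
rewrite le_eqVlt => /predU1P[<- _ _ _|ab hd hc hM]; first by rewrite !subrr mulr0.
have hd' x : x \in `]a, b[ -> is_derive x 1 h (dh x).
  by rewrite in_itv/=; exact: hd.
have [c] := MVT ab hd' hc.
by rewrite in_itv/= => cab ->; rewrite ler_wpM2r ?hM// subr_ge0 ltW.
Qed.

(** As [p2] may be discontinuous, no integral remainder is taken: the mean value inequality is
    applied to [p1], then to [p] minus a quadratic model. *)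
Lemma taylor2_le (p p1 p2 : R -> R) (K : R) :
  (forall t : R, is_derive t 1 p (p1 t)) -> (forall t : R, is_derive t 1 p1 (p2 t)) ->
  (forall t, p2 t <= K) -> p 1 - p 0 - p1 0 <= K / 2.
Proof.
move=> dp dp1 p2K.
have cont (h dh : R -> R) a b : (forall t : R, is_derive t 1 h (dh t)) ->
    {within `[a, b], continuous h}.
  by move=> hd; apply: derivable_within_continuous => x _; have := hd x.
have p1K t : 0 <= t -> p1 t - p1 0 <= K * t.
  move=> t0; rewrite -[t in K * t]subr0; apply: (@increment_le p1 p2) => //.
  exact: cont dp1.
pose h t := p t - t * p1 0 - K / 2 * t ^+ 2.
have dh t : is_derive (t : R) 1 h (p1 t - p1 0 - K * t).
  have ? := dp t.
  by apply: is_derive_eq; rewrite /GRing.scale/=; field.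
have h10 : h 1 - h 0 <= 0 * (1 - 0).
  apply: (increment_le ler01 (fun t _ => dh t)) => [|x /andP[/ltW/p1K ? _]].
    exact: cont dh.
  by lra.
by move: h10; rewrite /h; lra.
Qed.

End Derivatives.

(** * Lipschitz gradient from bounds on the Hessian quadratic form *)

Section GradientLipschitz.
Context {R : realType} {n : nat}.
Variables (f : 'rV[R]_n -> R) (K : R).
Hypothesis f_smooth : twice_differentiable f.
Hypothesis hess_le : forall x v, `|dotv (v *m hess f x) v| <= K * dotv v v.

(** Second-order Taylor estimate on the segment from [a] to [a + d], applied to [f] and to its
    opposite. *)
Lemma quadratic_bound (a d : 'rV[R]_n) :
  `|f (a + d) - f a - dotv (grad f a) d| <= K / 2 * dotv d d.
Proof.
pose c (t : R) := a + t *: d.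
have dc (t : R) : is_derive t 1 c d.
  apply: DeriveDef; first exact/diff_derivable.
  by rewrite deriveE// diff_val add0r scale1r.
pose p t := f (c t); pose p1 t := dotv (grad f (c t)) d.
pose p2 t := dotv (d *m hess f (c t)) d.
have dp (t : R) : is_derive t 1 p (p1 t).
  rewrite /p1 -diff_grad; last exact: f_smooth.1.
  apply: is_derive_diff_comp => //; exact: f_smooth.1.
have dp1 (t : R) : is_derive t 1 p1 (p2 t).
  have dg : is_derive t 1 (fun t => grad f (c t)) (d *m hess f (c t)).
    apply: is_derive_grad_comp => //; exact: f_smooth.2.
  apply: (is_derive_eq (is_derive_dotv dg (is_derive_cst d t 1))).
  by rewrite -(scale0r d) dotvZr mul0r addr0.
have p2K t : - (K * dotv d d) <= p2 t <= K * dotv d d by rewrite -ler_norml; exact: hess_le.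
have up : p 1 - p 0 - p1 0 <= K * dotv d d / 2.
  by apply: (taylor2_le dp dp1) => t; have /andP[] := p2K t.
have lo : - p 1 - - p 0 - - p1 0 <= K * dotv d d / 2.
  apply: (@taylor2_le _ (- p) (- p1) (- p2)) => t.
  by have /andP[] := p2K t; rewrite lerNl.
move: up lo; rewrite /p /p1 /c scale1r scale0r addr0 => up lo.
by rewrite ler_norml; apply/andP; split; lra.
Qed.

(* Compare the quadratic models at [x] and [y] in the two points
   [(x + y) / 2 + w] and [(x + y) / 2 - w]. *)
Lemma grad_polarization (x e w : 'rV[R]_n) :
  dotv (grad f (x + 2 *: e) - grad f x) w <= K * (dotv w w + dotv e e).
Proof.
set y := x + 2 *: e.
have q1 := quadratic_bound x (e - w); have q2 := quadratic_bound x (e + w).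
have q3 := quadratic_bound y (- (e - w)); have q4 := quadratic_bound y (- (e + w)).
have e1 : y - (e - w) = x + (e + w).
  by apply/rowP => i; rewrite !mxE; ring.
have e2 : y - (e + w) = x + (e - w).
  by apply/rowP => i; rewrite !mxE; ring.
move: q1 q2 q3 q4; rewrite e1 e2 !ler_norml !dotvE !(dotvC w e).
move=> /andP[q1 q1'] /andP[q2 q2'] /andP[q3 q3'] /andP[q4 q4'].
(* The values of [f] cancel in pairs, and the parallelogram law collects the quadratic terms. *)
lra.
Qed.

(** Polarization yields the constant from the quadratic form alone, without an operator norm or
    symmetry of the Hessian. *)
Lemma grad_lipschitz (x y : 'rV[R]_n) :
  enorm (grad f y - grad f x) <= K * enorm (y - x).
Proof.
have [<-|xy] := eqVneq x y.
  by rewrite !subrr -(scale0r 0) /enorm dotvZl mul0r sqrtr0 mulr0.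
have K0 : 0 <= K.
  have D0 : 0 < dotv (y - x) (y - x).
    by rewrite -sqr_enorm exprn_gt0// enorm_gt0 subr_eq0 eq_sym.
  by rewrite -(pmulr_lge0 _ D0); apply: le_trans (hess_le x (y - x)).
set G := grad f y - grad f x; set D := enorm (y - x).
have D_gt0 : 0 < D by rewrite enorm_gt0 subr_eq0 eq_sym.
have [->|G0] := eqVneq G 0.
  by rewrite -(scale0r 0) /enorm dotvZl mul0r sqrtr0 mulr_ge0// ltW.
have G_gt0 : 0 < enorm G by rewrite enorm_gt0.
(* This scaling gives [t *: G] the length [D / 2] of the half-step, which balances the two quadratic
   terms. *)
set t := D / (2 * enorm G).
have := grad_polarization x (2^-1 *: (y - x)) (t *: G).
rewrite scalerA divff ?pnatr_eq0// scale1r subrKC -/G.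
rewrite !(dotvZl, dotvZr) -!sqr_enorm -/D.
have -> : t * enorm G ^+ 2 = D * enorm G / 2.
  by rewrite /t; field; rewrite gt_eqF.
have -> : t * (D * enorm G / 2) = D ^+ 2 / 4.
  by rewrite /t; field; rewrite gt_eqF.
move=> h; rewrite -(ler_pM2l D_gt0); lra.
Qed.

End GradientLipschitz.

(** * Loewner bounds as quadratic-form bounds *)

Section HessianBound.
Context {R : realType} {n : nat}.

Lemma loewner_hess_bounds (A : 'M[R]_n) (l L : R) v :
  loewner_le (- (l *: 1%:M)) A -> loewner_le A (L *: 1%:M) ->
  - l * dotv v v <= dotv (v *m A) v <= L * dotv v v.
Proof.
move=> /(_ v) + /(_ v).
rewrite !(mulmxBr, mulmxN) -!scalemxAr mulmx1 !dotvE => h1 h2.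
by apply/andP; split; lra.
Qed.

End HessianBound.

(** * Estimates along one flow arc starting from a reset state *)

Section Flow.
Context {R : realType} {n : nat}.

Lemma cvg_dotv {T : Type} {F : set_system T} {FF : Filter F}
    (c d : T -> 'rV[R]_n) (u v : 'rV[R]_n) :
  c @ F --> u -> d @ F --> v -> dotv (c x) (d x) @[x --> F] --> dotv u v.
Proof.
move=> cu dv; rewrite /dotv; 
apply: cvg_big => [|i _]; first exact: add_continuous.
have coord (e : T -> 'rV[R]_n) (w : 'rV[R]_n) : e @ F --> w -> e x 0 i @[x --> F] --> w 0 i.
  by move=> ew; exact: (cvg_comp _ _ ew (@coord_continuous R 1 n 0 i w)).
by apply: cvgM; exact: coord.
Qed.

Lemma is_derive_expR_affine (k a t : R) :
  is_derive t 1 (fun s => expR (k * (s - a))) (k * expR (k * (t - a))).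
Proof.
have d1 : is_derive t 1 (fun s => k * (s - a)) k.
  by apply: is_derive_eq; rewrite /GRing.scale/=; ring.
have := @is_derive1_comp _ expR (fun s => k * (s - a)) t _ _ (is_derive_expR _) d1.
by rewrite mulrC.
Qed.

Lemma continuous_expR_affine (k a : R) : continuous (fun s => expR (k * (s - a))).
Proof.
move=> t; apply/differentiable_continuous/derivable1_diffP.
by have := is_derive_expR_affine k a t.
Qed.

Variables (f : 'rV[R]_n -> R) (K alpha beta ulo uhi U a b : R).
Variables (x0 : 'rV[R]_n) (p : R -> 'rV[R]_n * 'rV[R]_n).
Hypotheses (f_smooth : twice_differentiable f) (beta_ge0 : 0 <= beta).
Hypotheses (U_ge0 : 0 <= U) (uhi_le : uhi <= U).
Hypothesis p_start : p a = (x0, - (beta *: grad f x0)).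
Hypothesis p_cont : {within `[a, b], continuous p}.
Hypothesis p_flow_set : forall s, a < s < b -> C_II f alpha ulo uhi (p s).
Hypothesis p_x1 : forall s, a < s < b -> is_derive s 1 (fun t : R => (p t).1) (p s).2.
Hypothesis p_x2 : forall s, a < s < b ->
  is_derive s 1 (fun t : R => (p t).2)
    (- (p s).2 - u_II f alpha (p s) *: grad f (p s).1).

Let within_cont (F : 'rV[R]_n * 'rV[R]_n -> R) t :
  continuous F -> t <= b -> {within `[a, t], continuous (F \o p)}.
Proof.
move=> cF tb; have pt : {within `[a, t], continuous p}.
  apply: continuous_subspaceW p_cont => s /=; rewrite !in_itv/= => /andP[-> st].
  exact: le_trans tb.
by move=> s; exact: (@continuous_comp (subspace `[a, t]) _ _ p F s (pt s) (cF _)).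
Qed.

Let grad_cont : continuous (grad f).
Proof. by move=> x; apply: differentiable_continuous; exact: f_smooth.2. Qed.

Let sigma t := dotv (grad f (p t).1) (p t).2.
Let sqgrad0 := dotv (grad f x0) (grad f x0).

Let sigma_cont t : t <= b -> {within `[a, t], continuous sigma}.
Proof.
apply: (@within_cont (fun q => dotv (grad f q.1) q.2)) => q.
apply: cvg_dotv; last exact: cvg_snd.
by apply: (cvg_comp _ _ cvg_fst); exact: grad_cont.
Qed.

Let u_sqgrad s : a < s < b ->
  u_II f alpha (p s) * dotv (grad f (p s).1) (grad f (p s).1) =
  dotv ((p s).2 *m hess f (p s).1) (p s).2 - (1 - alpha) * sigma s.
Proof.
move=> /p_flow_set[/eqP g0 _].
by rewrite /u_II sqr_enorm divfK ?dotv_eq0// dotvNr mulrN.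
Qed.

(* [u_II] is designed to cancel the Hessian term, leaving
   [d/dt <grad f x1, x2> = - alpha <grad f x1, x2>]. *)
Lemma flow_dotv_grad t : a <= t <= b ->
  sigma t = - (beta * sqgrad0) * expR (- alpha * (t - a)).
Proof.
move=> /andP[at_ tb].
have ds s : a < s < b -> is_derive s 1 sigma (- alpha * sigma s).
  move=> sab; have sg := is_derive_grad_comp (f_smooth.2 _) (p_x1 sab).
  apply: (is_derive_eq (is_derive_dotv sg (p_x2 sab))).
  by rewrite !dotvE u_sqgrad// /sigma; ring.
(* With the integrating factor the derivative vanishes, so the product is constant on the arc. *)
have dh s : s \in `]a, t[ ->
    is_derive s 1 (fun s => sigma s * expR (alpha * (s - a))) ((fun=> 0) s).
  rewrite in_itv/= => /andP[as_ st].
  have sab : a < s < b by rewrite as_ (lt_le_trans st).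
  have ? := ds s sab; have ? := is_derive_expR_affine alpha a s.
  by apply: is_derive_eq; rewrite /GRing.scale/=; ring.
have [|c _] := MVT_segment at_ dh.
  move=> s; apply: cvgM; first exact: (sigma_cont tb).
  by have /continuous_subspaceT := @continuous_expR_affine alpha a; apply.
rewrite mul0r subrr mulr0 expR0 mulr1 => /eqP; rewrite subr_eq0 => /eqP h.
rewrite [- alpha * _]mulNr expRN -[LHS](mulfK (negbT (expR_eq0 (alpha * (t - a))))) h.
by rewrite /sigma p_start /= !dotvE.
Qed.

Hypothesis alpha_ge0 : 0 <= alpha.

Lemma flow_dotv_grad_bounds t : a <= t <= b ->
  - (beta * sqgrad0) <= sigma t <= 0.
Proof.
move=> tab; rewrite flow_dotv_grad// mulNr lerN2 oppr_le0.
have B0 : 0 <= beta * sqgrad0 by rewrite mulr_ge0// dotv_ge0.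
rewrite mulr_ge0 ?expR_ge0// andbT ler_piMr// expR_le1 mulNr oppr_le0.
by rewrite mulr_ge0// subr_ge0; case/andP: tab.
Qed.

(* Gronwall for [y = |x2|^2], since [y' = - 2 y - 2 u sigma]. *)
Lemma flow_sqspeed_le t : a <= t <= b ->
  dotv (p t).2 (p t).2 <=
  sqgrad0 * (beta * U + (beta ^+ 2 - beta * U) * expR (- 2 * (t - a))).
Proof.
move=> /andP[at_ tb]; set q := expR _.
(* [B] is the equilibrium of the comparison equation [y' = - 2 y + 2 B]; [h], the deviation from it
   times the integrating factor, is nonincreasing. *)
pose y s := dotv (p s).2 (p s).2; pose B := beta * U * sqgrad0.
pose h s := (y s - B) * expR (2 * (s - a)).
pose dh s := (- 2 * u_II f alpha (p s) * sigma s - 2 * B) * expR (2 * (s - a)).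
have hd s : a < s < t -> is_derive s 1 h (dh s).
  move=> /andP[as_ st]; have sab : a < s < b by rewrite as_ (lt_le_trans st).
  have dy : is_derive s 1 y (- 2 * y s - 2 * u_II f alpha (p s) * sigma s).
    apply: (is_derive_eq (is_derive_dotv (p_x2 sab) (p_x2 sab))).
    by rewrite !dotvE (dotvC (p s).2 (grad f _)) /y /sigma; ring.
  have ? := is_derive_expR_affine 2 a s.
  by apply: is_derive_eq; rewrite /GRing.scale/= /dh; ring.
have hle : h t - h a <= 0 * (t - a).
  apply: (increment_le at_ hd) => [s|s /andP[as_ st]].
    apply: cvgM; last first.
      by have /continuous_subspaceT := @continuous_expR_affine 2 a; apply.
    apply: cvgB; last exact: cvg_cst.
    apply: (@within_cont (fun q => dotv q.2 q.2)) => // x.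
    by apply: cvg_dotv; exact: cvg_snd.
  have sab : a < s < b by rewrite as_ (lt_le_trans st).
  have [_ /andP[ulo_u u_uhi]] := p_flow_set sab.
  have /andP[s1 s2] : - (beta * sqgrad0) <= sigma s <= 0.
    by apply: flow_dotv_grad_bounds; rewrite !ltW//; case/andP: sab.
  rewrite /dh mulr_le0_ge0 ?expR_ge0//.
  (* Together these give [- u sigma <= - U sigma <= B], by the signs and bounds of [sigma]. *)
  have : 0 <= U * (sigma s + beta * sqgrad0) by rewrite mulr_ge0// -lerBlDr sub0r.
  have : 0 <= (U - u_II f alpha (p s)) * - sigma s.
    by rewrite mulr_ge0 ?oppr_ge0// subr_ge0 (le_trans u_uhi).
  rewrite /B; lra.
move: hle; rewrite mul0r subr_le0 /h subrr mulr0 expR0 mulr1 => hle.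
have qE : expR (2 * (t - a)) * q = 1 by rewrite -expRD mulNr subrr expR0.
have := ler_wpM2r (expR_ge0 (- 2 * (t - a))) hle.
rewrite -/q -mulrA qE mulr1 /y p_start /= !dotvE -/sqgrad0 /B; lra.
Qed.

(** Whatever the sign of [beta ^+ 2 - beta * U], a factor [q] in [0, 1] leaves at most
    [beta ^+ 2 + beta * U]. *)
Lemma flow_speed_le t : a <= t <= b ->
  enorm (p t).2 <= enorm (grad f x0) * Num.sqrt (beta ^+ 2 + beta * U).
Proof.
move=> tab; rewrite -sqrtrM ?dotv_ge0// ler_sqrt.
  apply: le_trans (flow_sqspeed_le tab) _.
  rewrite ler_wpM2l ?dotv_ge0//.
  set q := expR _; have q0 : 0 <= q := expR_ge0 _.
  have q1 : q <= 1.
    by rewrite expR_le1 mulNr oppr_le0 mulr_ge0// subr_ge0; case/andP: tab.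
  have := mulr_ge0 (mulr_ge0 beta_ge0 U_ge0) q0.
  have := ler_piMr (sqr_ge0 beta) q1; lra.
by rewrite mulr_ge0 ?dotv_ge0 ?addr_ge0 ?sqr_ge0 ?mulr_ge0.
Qed.

(** Mean value inequality for the product of [(p s).1] with the fixed vector [w], the final
    displacement, then Cauchy-Schwarz. *)
Lemma flow_displacement_le t : a <= t <= b ->
  enorm ((p t).1 - x0) <=
  (t - a) * (enorm (grad f x0) * Num.sqrt (beta ^+ 2 + beta * U)).
Proof.
move=> /andP[at_ tb]; set M := enorm _ * _.
have M0 : 0 <= M by rewrite mulr_ge0 ?enorm_ge0 ?sqrtr_ge0.
apply: enorm_le_dual; last by rewrite mulr_ge0// subr_ge0.
set w := (p t).1 - x0.
have -> : dotv w w = dotv (p t).1 w - dotv (p a).1 w.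
  by rewrite p_start /= -dotvNl -dotvDl.
rewrite -mulrA mulrC.
apply: (@increment_le _ (fun s => dotv (p s).1 w) (fun s => dotv (p s).2 w)) => //.
- move=> s /andP[as_ st]; have sab : a < s < b by rewrite as_ (lt_le_trans st).
  apply: (is_derive_eq (is_derive_dotv (p_x1 sab) (is_derive_cst w s 1))).
  by rewrite -(scale0r w) dotvZr mul0r addr0.
- apply: (@within_cont (fun q => dotv q.1 w)) => // x.
  by apply: cvg_dotv; [exact: cvg_fst|exact: cvg_cst].
- move=> s /andP[as_ st]; apply: (le_trans (dotv_le_enorm _ _)).
  rewrite ler_wpM2r ?enorm_ge0// flow_speed_le//.
  by rewrite !ltW// (lt_le_trans st).
Qed.

End Flow.

(** * Scalar inequalities relative to the current gradient *)

Section ReturnEstimates.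
Context {R : realFieldType}.
Variables (beta U omega tau r rho : R).
Hypotheses (beta_ge0 : 0 <= beta) (U_ge0 : 0 <= U) (omega_ge0 : 0 <= omega).
Hypotheses (tau_ge0 : 0 <= tau) (r_ge0 : 0 <= r) (r_lt1 : r < 1).
Hypotheses (omega_tau : omega * tau <= r) (rho_ge0 : 0 <= rho).
Hypothesis rho_dist : `|rho - 1| <= omega * tau.

(** [rho] stands for the current gradient norm over the initial one, so [rho >= 1 - r]. The cube is
    weaker than the square this gives, and matches the constants of the theorem. *)
Let sqrho_ge (c : R) : 0 <= c -> c <= c / (1 - r) ^+ 3 * rho ^+ 2.
Proof.
move=> c0; set d := 1 - r; have d0 : 0 < d by rewrite subr_gt0.
have /andP[rho1 _] : - (omega * tau) <= rho - 1 <= omega * tau by rewrite -ler_norml.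
have drho : d <= rho by move: omega_tau; rewrite /d; lra.
rewrite mulrAC ler_pdivlMr ?exprn_gt0// ler_wpM2l//.
have d1 : d <= 1 by move: r_ge0; rewrite /d; lra.
apply: (@le_trans _ _ (d ^+ 2)); last by rewrite ler_pXn2r ?nnegrE// ltW.
by rewrite exprSr ler_piMr// exprn_ge0// ltW.
Qed.

Let sqrho_defect : 1 - rho ^+ 2 <= 2 * (omega * tau).
Proof.
have /andP[rho1 _] : - (omega * tau) <= rho - 1 <= omega * tau by rewrite -ler_norml.
have := mulr_ge0 omega_ge0 tau_ge0; nra.
Qed.

(** [y] is the squared speed over the initial squared gradient norm, [q] is [exp(-2 tau)]. Replacing
    [beta ^+ 2] by [beta ^+ 2 * rho ^+ 2] costs a term linear in [tau]; [sqrho_ge] absorbs all such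
    terms. *)
Lemma sqspeed_ratio_le y q :
  1 - 2 * tau <= q <= 1 -> y <= beta * U + (beta ^+ 2 - beta * U) * q ->
  y <= (beta ^+ 2 + 2 * beta * (U + omega * (beta + U)) / (1 - r) ^+ 3 * tau)
       * rho ^+ 2.
Proof.
move=> /andP[q1 q2] yq.
have bU : 0 <= beta * U by exact: mulr_ge0.
have ybU : y <= beta ^+ 2 + 2 * (beta * U * tau).
  have := ler_wpM2l bU q1; have := ler_piMr (sqr_ge0 beta) q2; lra.
set A := 2 * beta * (U + omega * (beta + U)).
have A0 : 0 <= A * tau by rewrite /A !mulr_ge0 ?addr_ge0 ?mulr_ge0 ?addr_ge0.
have h := sqrho_ge A0; set iD := _^-1 in h *.
rewrite mulrDl; apply: (le_trans ybU).
have : 2 * (beta ^+ 2 * (omega * tau)) + 2 * (beta * U * tau) <= A * tau.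
  have : 0 <= beta * omega * U * tau by rewrite !mulr_ge0.
  rewrite /A; lra.
have := ler_wpM2l (sqr_ge0 beta) sqrho_defect; lra.
Qed.

(** [beta * q], with [q] the decay [exp(- alpha tau)], is minus [sigma] over the initial squared
    gradient norm. *)
Lemma decay_ratio_bounds alpha q : 0 <= alpha -> 0 <= q ->
  1 - alpha * tau <= q <= 1 ->
  let c := 2 * omega * beta / (1 - r) ^+ 3 + alpha * beta * (1 + r) in
  (beta - c * tau) * rho ^+ 2 <= beta * q /\
  beta * q <= (beta + c * tau) * rho ^+ 2.
Proof.
move=> alpha0 q0 /andP[q1 q2] /=.
have bq := ler_piMr beta_ge0 q2.
have ab : 0 <= alpha * beta * (1 + r) * tau by rewrite !mulr_ge0 ?addr_ge0.
have A0 : 0 <= 2 * omega * beta * tau by rewrite !mulr_ge0.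
have ot : 0 <= omega * tau by exact: mulr_ge0.
have h := sqrho_ge A0.
set c := 2 * omega * beta / _; have ctE : c * tau = 2 * omega * beta * tau / (1 - r) ^+ 3.
  by rewrite /c mulrAC.
split; last first.
  have := ler_wpM2l beta_ge0 sqrho_defect.
  have := mulr_ge0 ab (sqr_ge0 rho).
  move: h; rewrite -ctE; lra.
have c_ge : 2 * omega * beta * tau <= c * tau.
  rewrite ctE ler_peMr// invf_ge1 ?exprn_gt0 ?subr_gt0//.
  by rewrite exprn_ile1 ?gerBl ?subr_ge0 ?(ltW r_lt1).
have ab_ge : alpha * beta * tau <= alpha * beta * (1 + r) * tau.
  by rewrite ler_wpM2r// ler_peMr ?mulr_ge0// lerDl.
have /andP[_ rho2] : - (omega * tau) <= rho - 1 <= omega * tau by rewrite -ler_norml.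
set x := omega * tau in ot rho2 *; set at_ := alpha * tau.
have at0 : 0 <= at_ by exact: mulr_ge0.
apply: (@le_trans _ _ (beta * (1 - 2 * x - at_) * rho ^+ 2)).
  rewrite ler_wpM2r ?sqr_ge0// /x /at_; lra.
rewrite -mulrA ler_wpM2l//.
(* Only a positive factor allows replacing [rho] by its upper bound [1 + x]; otherwise [0 <= q]
   suffices. *)
have [neg|pos] := lerP (1 - 2 * x - at_) 0.
  by apply: le_trans q0; rewrite mulr_le0_ge0 ?sqr_ge0.
apply: le_trans q1; rewrite -/at_.
apply: (@le_trans _ _ ((1 - 2 * x - at_) * (1 + x) ^+ 2)).
  by rewrite ler_wpM2l ?(ltW pos)// ler_pXn2r ?nnegrE ?addr_ge0//; lra.
(* The linear terms cancel: [(1 - 2x)(1 + x)^2 = 1 - 3x^2 - 2x^3]. *)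
have := mulr_ge0 at0 ot; have := mulr_ge0 at0 (mulr_ge0 ot ot).
have := mulr_ge0 ot (mulr_ge0 ot ot); have := mulr_ge0 ot ot; lra.
Qed.

End ReturnEstimates.

(** * A sufficient condition for interior points of the flow set *)

Section FlowSetInterior.
Context {R : realType} {n : nat}.
Variables (f : 'rV[R]_n -> R) (alpha ulo uhi lf Lf : R).
Hypothesis f_smooth : twice_differentiable f.
Hypothesis hess_bd : forall x v : 'rV[R]_n,
  - lf * dotv v v <= dotv (v *m hess f x) v <= Lf * dotv v v.

(* The Hessian need not be continuous, so [u_II] need not be either; its
   envelopes obtained from the Hessian bounds are. *)
Lemma interior_flow_set (x : 'rV[R]_n * 'rV[R]_n) :
  grad f x.1 != 0 ->
  Lf * dotv x.2 x.2 - (1 - alpha) * dotv (grad f x.1) x.2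
    < uhi * dotv (grad f x.1) (grad f x.1) ->
  ulo * dotv (grad f x.1) (grad f x.1)
    < - lf * dotv x.2 x.2 - (1 - alpha) * dotv (grad f x.1) x.2 ->
  interior (C_II f alpha ulo uhi) x.
Proof.
move=> g0 hi lo.
have cg : grad f z.1 @[z --> x] --> grad f x.1.
  apply: (cvg_comp _ _ cvg_fst).
  by apply: differentiable_continuous; exact: f_smooth.2.
have c2 : z.2 @[z --> x] --> x.2 by exact: cvg_snd.
have cvg_dot := @cvg_dotv R n _ _ (nbhs_filter x).
have cgg := cvg_dot _ _ _ _ cg cg; have cgx := cvg_dot _ _ _ _ cg c2.
have cxx := cvg_dot _ _ _ _ c2 c2.
have cst_ (k : R) : k @[_ --> x] --> k by exact: cvg_cst.
have gt0_near (h : 'rV[R]_n * 'rV[R]_n -> R) :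
    h z @[z --> x] --> h x -> 0 < h x -> \forall z \near x, 0 < h z.
  by move=> hx; exact: (cvgr_gt (h x) hx 0).
(* The margins of the two inequalities, denominators cleared; both are continuous in the state. *)
pose hiF (z : 'rV[R]_n * 'rV[R]_n) := uhi * dotv (grad f z.1) (grad f z.1) -
  (Lf * dotv z.2 z.2 - (1 - alpha) * dotv (grad f z.1) z.2).
pose loF (z : 'rV[R]_n * 'rV[R]_n) := - lf * dotv z.2 z.2 -
  (1 - alpha) * dotv (grad f z.1) z.2 - ulo * dotv (grad f z.1) (grad f z.1).
have near_g : \forall z \near x, 0 < dotv (grad f z.1) (grad f z.1).
  apply: (gt0_near (fun z => dotv (grad f z.1) (grad f z.1)) cgg).
  by rewrite lt_def dotv_ge0 dotv_eq0 g0.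
have near_hi : \forall z \near x, 0 < hiF z.
  apply: (gt0_near hiF); last by rewrite subr_gt0.
  by apply: cvgB; [|apply: cvgB]; apply: cvgM.
have near_lo : \forall z \near x, 0 < loF z.
  apply: (gt0_near loF); last by rewrite subr_gt0.
  by apply: cvgB; [apply: cvgB|]; apply: cvgM.
rewrite /interior /=; near=> z.
have gz : 0 < dotv (grad f z.1) (grad f z.1) by near: z.
have : 0 < hiF z by near: z.
have : 0 < loF z by near: z.
rewrite /hiF /loF => lz hz; have /andP[h1 h2] := hess_bd z.1 z.2.
split.
  by move=> gz0; move: gz; rewrite lt_def dotv_eq0 gz0 eqxx.
rewrite /u_II sqr_enorm dotvNr ler_pdivlMr// ler_pdivrMr//.
by apply/andP; split; lra.
Unshelve. all: by end_near. Qed.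

End FlowSetInterior.

(** The bound of the theorem as a function of the constants, so that it can also be used with an
    enlarged [Lf]. *)
Definition dwell_bound {R : realType} (alpha beta lf Lf ulo uhi r : R) : R :=
  let delta := Num.min (uhi - (Lf * beta ^+ 2 + (1 - alpha) * beta))
                       ((- lf * beta ^+ 2 + (1 - alpha) * beta) - ulo) in
  let U := Num.max uhi (- ulo) in
  let cLf := Num.max lf Lf in
  let omega := cLf * Num.sqrt (beta ^+ 2 + beta * U) in
  let b1 := 2 * cLf * beta * (U + omega * (beta + U)) / (1 - r) ^+ 3 in
  let b2 := `|alpha - 1| * (2 * omega * beta / (1 - r) ^+ 3)
            + `|alpha - 1| * alpha * beta * (1 + r) in
  Num.min (r * omega^-1) (delta * (b1 + b2)^-1).

(** * No exit from the flow set before the dwell bound *)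

Section Dwell.
Context {R : realType}.
Variables (alpha beta lf Lf ulo uhi : R).
Hypotheses (alpha_ge0 : 0 <= alpha) (beta_ge0 : 0 <= beta).
Hypotheses (lf_ge0 : 0 <= lf) (Lf_ge0 : 0 <= Lf).
Hypothesis ulo_lt : ulo < - lf * beta ^+ 2 + (1 - alpha) * beta.
Hypothesis uhi_gt : Lf * beta ^+ 2 + (1 - alpha) * beta < uhi.

Let U := Num.max uhi (- ulo).
Let L := Num.max lf Lf.

(** The two strict inequalities force [ulo < uhi], so [uhi] and [- ulo] cannot both be
    nonpositive. *)
Lemma max_input_gt0 : 0 < U.
Proof.
have h1 := mulr_ge0 lf_ge0 (sqr_ge0 beta); have h2 := mulr_ge0 Lf_ge0 (sqr_ge0 beta).
have u12 : ulo < uhi by move: ulo_lt uhi_gt h1 h2; lra.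
by rewrite lt_max; have [//|] := ltP 0 uhi => /(lt_le_trans u12); rewrite oppr_gt0.
Qed.

Lemma dwell_bound_gt0 (r : R) : 0 < beta -> 0 < Lf -> 0 < r < 1 ->
  0 < dwell_bound alpha beta lf Lf ulo uhi r.
Proof.
move=> b0 Lf0 /andP[r0 r1]; have U0 := max_input_gt0.
rewrite /dwell_bound -/U -/L.
have L0 : 0 < L by rewrite lt_max Lf0 orbT.
set omega := L * Num.sqrt _.
have om0 : 0 < omega by rewrite mulr_gt0// sqrtr_gt0 addr_gt0 ?exprn_gt0 ?mulr_gt0.
have r10 : 0 < 1 - r by rewrite subr_gt0.
rewrite lt_min divr_gt0//= divr_gt0//; first by rewrite lt_min !subr_gt0 uhi_gt.
apply: ltr_pwDl.
  by rewrite divr_gt0 ?exprn_gt0// !mulr_gt0// addr_gt0// mulr_gt0// addr_gt0.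
apply: addr_ge0.
  by rewrite mulr_ge0// divr_ge0 ?exprn_ge0 ?(ltW r10)// !mulr_ge0// ltW.
by rewrite !mulr_ge0// addr_ge0// ltW.
Qed.

Context {n : nat}.
Variables (f : 'rV[R]_n -> R) (a b : R) (x0 : 'rV[R]_n).
Variable (p : R -> 'rV[R]_n * 'rV[R]_n).
Hypotheses (f_smooth : twice_differentiable f) (a_le_b : a <= b).
Hypothesis hess_bd : forall x v : 'rV[R]_n,
  - lf * dotv v v <= dotv (v *m hess f x) v <= Lf * dotv v v.
Hypothesis grad0_neq0 : grad f x0 != 0.
Hypothesis p_start : p a = (x0, - (beta *: grad f x0)).
Hypothesis p_cont : {within `[a, b], continuous p}.
Hypothesis p_flow_set : forall s, a < s < b -> C_II f alpha ulo uhi (p s).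
Hypothesis p_x1 : forall s, a < s < b ->
  is_derive s 1 (fun t : R => (p t).1) (p s).2.
Hypothesis p_x2 : forall s, a < s < b ->
  is_derive s 1 (fun t : R => (p t).2)
    (- (p s).2 - u_II f alpha (p s) *: grad f (p s).1).

Lemma flow_set_interior_before_dwell_bound (r : R) : 0 < r < 1 ->
  b - a < dwell_bound alpha beta lf Lf ulo uhi r ->
  interior (C_II f alpha ulo uhi) (p b).
Proof.
move=> /andP[r0 r1]; rewrite /dwell_bound -/U -/L.
have U0 : 0 <= U by exact/ltW/max_input_gt0.
have L0 : 0 <= L by rewrite le_max lf_ge0.
set V := Num.sqrt _; set omega := L * V; set tau := b - a.
have tau0 : 0 <= tau by rewrite subr_ge0.
have om0 : 0 <= omega by rewrite mulr_ge0// sqrtr_ge0.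
set c1 := 2 * beta * (U + omega * (beta + U)) / (1 - r) ^+ 3.
set c2 := 2 * omega * beta / (1 - r) ^+ 3 + alpha * beta * (1 + r).
(* [c1] and [c2] are the drift rates of the ratios starting at [beta ^+ 2] and [beta]. *)
have -> : 2 * L * beta * (U + omega * (beta + U)) / (1 - r) ^+ 3 +
    (`|alpha - 1| * (2 * omega * beta / (1 - r) ^+ 3) +
     `|alpha - 1| * alpha * beta * (1 + r)) = L * c1 + `|alpha - 1| * c2.
  by rewrite /c1 /c2; ring.
have c10 : 0 <= c1.
  rewrite divr_ge0 ?exprn_ge0 ?subr_ge0 ?(ltW r1)// !mulr_ge0//.
  by rewrite addr_ge0// mulr_ge0// addr_ge0.
have c20 : 0 <= c2.
  apply: addr_ge0; last by rewrite !mulr_ge0// addr_ge0// ltW.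
  by rewrite divr_ge0 ?exprn_ge0 ?subr_ge0 ?(ltW r1)// mulr_ge0// mulr_ge0.
rewrite lt_min => /andP[tau_r tau_delta].
(* If [omega] were 0, its inverse would be 0 by convention, giving [tau < 0]. *)
have om_gt0 : 0 < omega.
  rewrite lt_def om0 andbT; apply: contraTneq tau_r => ->.
  by rewrite invr0 mulr0 -leNgt.
have om_tau : omega * tau <= r by rewrite mulrC ltW// -ltr_pdivlMr.
set B := L * c1 + _ in tau_delta.
have B0 : 0 <= B by apply: addr_ge0; apply: mulr_ge0.
have B_gt0 : 0 < B.
  rewrite lt_def B0 andbT; apply: contraTneq tau_delta => ->.
  by rewrite invr0 mulr0 -leNgt.
move: tau_delta; rewrite ltr_pdivlMr// lt_min => /andP[tau_hi tau_lo].
have Uhi : uhi <= U by rewrite le_max lexx.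
have bb : a <= b <= b by rewrite a_le_b lexx.
set g0 := enorm (grad f x0); have g0_gt0 : 0 < g0 by rewrite enorm_gt0.
set g := grad f (p b).1; set rho := enorm g / g0.
have hess_le x v : `|dotv (v *m hess f x) v| <= L * dotv v v.
  have /andP[h1 h2] := hess_bd x v; have vv := dotv_ge0 v.
  have := ler_wpM2r vv (_ : lf <= L); have := ler_wpM2r vv (_ : Lf <= L).
  rewrite !le_max !lexx orbT => /(_ isT) k1 /(_ isT) k2.
  by rewrite ler_norml; apply/andP; split; lra.
(* Reverse triangle inequality, Lipschitz gradient, displacement bound. *)
have rho_dist : `|rho - 1| <= omega * tau.
  rewrite -(divff (negbT (gt_eqF g0_gt0))) -mulrBl.
  rewrite normrM [`|g0^-1|]gtr0_norm ?invr_gt0// ler_pdivrMr//.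
  apply: (le_trans (enormB_dist _ _)).
  apply: (le_trans (grad_lipschitz f_smooth hess_le _ _)).
  rewrite /omega -!mulrA ler_wpM2l// mulrC -mulrA.
  exact: (flow_displacement_le f_smooth beta_ge0 U0 Uhi p_start p_cont
    p_flow_set p_x1 p_x2 alpha_ge0 bb).
have rho0 : 0 <= rho by rewrite divr_ge0 ?enorm_ge0.
have ggE : dotv g g = dotv (grad f x0) (grad f x0) * rho ^+ 2.
  by rewrite -!sqr_enorm -/g0 -exprMn mulrC divfK ?gt_eqF.
have gg0_gt0 : 0 < dotv (grad f x0) (grad f x0).
  by rewrite lt_def dotv_ge0 dotv_eq0 grad0_neq0.
have rho_gt0 : 0 < rho.
  move: rho_dist; rewrite ler_norml => /andP[rho1 _].
  by move: om_tau r1 rho1; lra.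
have gg_gt0 : 0 < dotv g g by rewrite ggE mulr_gt0 ?exprn_gt0.
have expR_bounds (k : R) : 0 <= k -> 1 - k * tau <= expR (- k * tau) <= 1.
  move=> k0; rewrite expR_le1 mulNr oppr_le0 mulr_ge0// andbT.
  exact: expR_ge1Dx.
have xx_le : dotv (p b).2 (p b).2 <= (beta ^+ 2 + c1 * tau) * dotv g g.
  apply: (le_trans (flow_sqspeed_le f_smooth beta_ge0 U0 Uhi p_start p_cont
    p_flow_set p_x1 p_x2 alpha_ge0 bb)).
  rewrite ggE mulrCA ler_wpM2l ?(ltW gg0_gt0)//.
  exact: (sqspeed_ratio_le beta_ge0 U0 om0 tau0 (ltW r0) r1 om_tau rho0 rho_dist
    (expR_bounds _ (ler0n _ 2)) (lexx _)).
have sigmaE := flow_dotv_grad f_smooth p_start p_cont p_flow_set p_x1 p_x2 bb.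
have [S_lo S_hi] := decay_ratio_bounds beta_ge0 om0 tau0 (ltW r0) r1 om_tau rho0
  rho_dist alpha_ge0 (expR_ge0 (- alpha * tau)) (expR_bounds _ alpha_ge0).
set S := - dotv g (p b).2.
have SE : S = dotv (grad f x0) (grad f x0) * (beta * expR (- alpha * tau)).
  by rewrite /S sigmaE; ring.
have S_dist : `|S - beta * dotv g g| <= c2 * tau * dotv g g.
  move: (ler_wpM2l (ltW gg0_gt0) S_lo) (ler_wpM2l (ltW gg0_gt0) S_hi).
  have sqE c : dotv (grad f x0) (grad f x0) * (c * rho ^+ 2) = c * dotv g g.
    by rewrite mulrCA -ggE.
  rewrite -SE !sqE -/c2 => h1 h2.
  by rewrite ler_norml; apply/andP; split; lra.
have aS_dist : `|(1 - alpha) * S - (1 - alpha) * beta * dotv g g| <=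
    `|alpha - 1| * c2 * tau * dotv g g.
  by rewrite -mulrA -mulrBr normrM distrC -!mulrA ler_wpM2l// !mulrA.
move: aS_dist; rewrite ler_norml => /andP[aS_lo aS_hi].
have c1g : 0 <= c1 * tau * dotv g g.
  by rewrite mulr_ge0 ?(ltW gg_gt0)// mulr_ge0.
have lfL : lf <= L by rewrite le_max lexx.
have LfL : Lf <= L by rewrite le_max lexx orbT.
have c1_lf := ler_wpM2r c1g lfL; have c1_Lf := ler_wpM2r c1g LfL.
have xx_lf := ler_wpM2l lf_ge0 xx_le; have xx_Lf := ler_wpM2l Lf_ge0 xx_le.
move: tau_hi tau_lo; rewrite -(ltr_pM2r gg_gt0) => tau_hi.
rewrite -(ltr_pM2r gg_gt0) => tau_lo.
(* After division by [dotv g g], both envelopes of the input have drifted by at most [B * tau],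
   which is below both margins. *)
apply: (interior_flow_set f_smooth hess_bd).
- by rewrite -/g -dotv_eq0 gt_eqF.
- rewrite -/g -mulrN -/S; move: tau_hi; rewrite /B; lra.
- rewrite -/g -mulrN -/S; move: tau_lo; rewrite /B; lra.
Qed.

End Dwell.

(** * Jump times of hybrid solutions *)

Section HybridSolution.
Context {R : realType}.

(** A jump time lies in arcs [j] and [j.+1], hence is their common endpoint. *)
Lemma time_domain_jump (E : nat -> set R) j s :
  hybrid_time_domain E -> jump_at E j s ->
  exists t : nat -> R, [/\ t 0%N = 0, t j.+1 = s,
    forall i, (i <= j.+1)%N -> t i <= t i.+1
    & forall i, (i <= j.+1)%N ->
        E i `&` [set s' | s' <= s] = [set s' | t i <= s' <= t i.+1]].
Proof.
move=> [_ _ dom] [Ej Ej1]; have [t [t0 tm tE]] := dom _ _ Ej1.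
exists t; split => //; apply/eqP; rewrite eq_le; apply/andP; split.
  have : [set s' | t j.+1 <= s' <= t j.+2] s by rewrite -tE//; split=> /=.
  by case/andP.
have : [set s' | t j <= s' <= t j.+1] s by rewrite -tE//; split=> /=.
by case/andP.
Qed.

Context {n : nat}.
Variables (f : 'rV[R]_n -> R) (alpha beta lf Lf ulo uhi : R).
Hypotheses (alpha_ge0 : 0 <= alpha) (beta_ge0 : 0 <= beta).
Hypotheses (lf_ge0 : 0 <= lf) (Lf_ge0 : 0 <= Lf).
Hypothesis ulo_lt : ulo < - lf * beta ^+ 2 + (1 - alpha) * beta.
Hypothesis uhi_gt : Lf * beta ^+ 2 + (1 - alpha) * beta < uhi.
Hypothesis f_smooth : twice_differentiable f.
Hypothesis hess_bd : forall x v : 'rV[R]_n,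
  - lf * dotv v v <= dotv (v *m hess f x) v <= Lf * dotv v v.
Variables (E : nat -> set R) (phi : nat -> R -> 'rV[R]_n * 'rV[R]_n).
Hypothesis sol : hybrid_solution_II f alpha beta ulo uhi E phi.

(** A boundary state is not interior, so it cannot occur before the bound. *)
Lemma dwell_time_ge j (a b r : R) (x0 : 'rV[R]_n) : 0 < r < 1 -> a <= b ->
  (forall s, a <= s <= b -> E j s) ->
  phi j a = (x0, - (beta *: grad f x0)) ->
  boundary (C_II f alpha ulo uhi) (phi j b) ->
  dwell_bound alpha beta lf Lf ulo uhi r <= b - a.
Proof.
move=> r01 ab abE start [_ not_int]; rewrite leNgt; apply/negP => short.
apply: not_int.
have intE s : a < s < b -> interior (E j) s.
  move=> sab; have sab' : s \in `]a, b[ by rewrite in_itv.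
  apply: filterS (near_in_itvoo sab') => z; rewrite in_itv/= => /andP[az zb].
  by apply: abE; rewrite !ltW.
apply: (flow_set_interior_before_dwell_bound alpha_ge0 beta_ge0 lf_ge0 Lf_ge0
  ulo_lt uhi_gt f_smooth ab hess_bd _ start _ _ _ _ r01 short).
- have := sol_in_domain sol (abE a _); rewrite start lexx ab => /(_ isT).
  by move/eqP.
- have cont : {within E j, continuous (phi j)} by exact: (sol_continuous sol).
  apply: continuous_subspaceW cont => s /=.
  by rewrite in_itv; exact: abE.
- by move=> s /intE; exact: (sol_flow_set sol).
- by move=> s /intE; exact: (sol_flow_x1 sol).
- by move=> s /intE; exact: (sol_flow_x2 sol).
Qed.

Lemma first_jump_ge (x0 : 'rV[R]_n) (r s : R) : 0 < r < 1 ->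
  phi 0%N 0 = (x0, - (beta *: grad f x0)) -> jump_at E 0 s ->
  dwell_bound alpha beta lf Lf ulo uhi r <= s.
Proof.
move=> r01 start js; have [t [t0 t1 tm tE]] := time_domain_jump (sol_time_domain sol) js.
have := tm 0%N isT; rewrite t0 t1 => s0; rewrite -[s]subr0.
apply: (dwell_time_ge r01 s0 _ start); last by have [] := sol_jump sol js.
move=> z zs; have : [set s' | t 0%N <= s' <= t 1%N] z by rewrite t0 t1.
by rewrite -tE// => -[].
Qed.

Lemma consecutive_jumps_ge j (r s s' : R) : 0 < r < 1 ->
  jump_at E j s -> jump_at E j.+1 s' ->
  dwell_bound alpha beta lf Lf ulo uhi r <= s' - s.
Proof.
move=> r01 js js'.
have [t [t0 ts' tm tE]] := time_domain_jump (sol_time_domain sol) js'.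
have [bd' _] := sol_jump sol js'; have [_ phiE] := sol_jump sol js.
(* The jump at [s'] ends arc [j.+1], so the time [s] of that arc cannot come later. *)
have ss' : s <= s'.
  rewrite leNgt; apply/negP => s's.
  exact: (sol_forced_jump sol js'.1 bd' s's js.2).
have tsE : t j.+1 = s.
  apply/eqP; rewrite eq_le; apply/andP; split.
    have : [set z | t j.+1 <= z <= t j.+2] s.
      by rewrite -tE//; split=> //; exact: js.2.
    by case/andP.
  have : [set z | t j <= z <= t j.+1] s.
    by rewrite -tE ?leqW//; split=> //; exact: js.1.
  by case/andP.
apply: (dwell_time_ge r01 ss' _ phiE bd') => z zs.
have : [set z | t j.+1 <= z <= t j.+2] z by rewrite tsE ts'.
by rewrite -tE// => -[].
Qed.

Lemma jumps_zeno_free (c : R) : 0 < c ->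
  (forall j s s', jump_at E j s -> jump_at E j.+1 s' -> c <= s' - s) ->
  zeno_free E.
Proof.
move=> c0 gap a b.
apply: (@sub_finite_set _ _ `I_(Num.bound (b / c)).+1); last exact: finite_II.
move=> j [s /andP[_ sb] js].
have [t [t0 tj tm tE]] := time_domain_jump (sol_time_domain sol) js.
have mem i z : (i <= j.+1)%N -> t i <= z <= t i.+1 -> E i z.
  by move=> ij zi; have : [set z | t i <= z <= t i.+1] z by []; rewrite -tE// => -[].
have jump i : (i <= j)%N -> jump_at E i (t i.+1).
  move=> ij; split; apply: mem.
  - exact: leqW.
  - by rewrite lexx tm// leqW.
  - by [].
  - by rewrite lexx tm.
(* The factor is [i], not [i.+1]: the initial state is arbitrary, so the first jump may come at time
   0. *)
have lower i : (i <= j)%N -> i%:R * c <= t i.+1.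
  elim: i => [_|i IH ij]; first by rewrite mul0r -t0 tm.
  have := gap _ _ _ (jump i (ltnW ij)) (jump _ ij).
  by have := IH (ltnW ij); rewrite -natr1; lra.
have := lower j (leqnn j); rewrite tj => jc.
have jbc : j%:R <= b / c by rewrite ler_pdivlMr// (le_trans jc).
have bc0 : 0 <= b / c by rewrite (le_trans _ jbc).
rewrite /= ltnS -(ler_nat R) (le_trans jbc)// ltW//.
exact: archi_boundP.
Qed.

End HybridSolution.

(** * Dwell time and Zeno-freeness for the hybrid system *)

Theorem theorem3p5 (R : realType) (n : nat) (f : 'rV[R]_n -> R)
    (fstar alpha lf Lf muf ulo uhi beta : R)
    (alpha_gt0 : 0 < alpha)
    (f_smooth : twice_differentiable f)
    (f_min : is_minimum_value f fstar)
    (lf_ge0 : 0 <= lf) (Lf_ge0 : 0 <= Lf) (muf_gt0 : 0 < muf)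
    (hess_bounds : forall x : 'rV[R]_n,
       loewner_le (- (lf *: 1%:M)) (hess f x) /\
       loewner_le (hess f x) (Lf *: 1%:M))
    (f_PL : forall x : 'rV[R]_n,
       muf * (f x - fstar) <= 2^-1 * enorm (grad f x) ^+ 2)
    (ulo_lt : ulo < - lf * beta ^+ 2 + (1 - alpha) * beta)
    (uhi_gt : Lf * beta ^+ 2 + (1 - alpha) * beta < uhi)
    (alpha_le : alpha <= 2 * muf * beta) :
  (forall (E : nat -> set R) (phi : nat -> R -> 'rV[R]_n * 'rV[R]_n)
          (x10 : 'rV[R]_n),
     hybrid_solution_II f alpha beta ulo uhi E phi ->
     phi 0%N 0 = (x10, - (beta *: grad f x10)) ->
     forall r : R, 0 < r < 1 ->
     let delta := Num.min (uhi - (Lf * beta ^+ 2 + (1 - alpha) * beta))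
                          ((- lf * beta ^+ 2 + (1 - alpha) * beta) - ulo) in
     let U := Num.max uhi (- ulo) in
     let cLf := Num.max lf Lf in
     let omega := cLf * Num.sqrt (beta ^+ 2 + beta * U) in
     let b1 := 2 * cLf * beta * (U + omega * (beta + U)) / (1 - r) ^+ 3 in
     let b2 := `|alpha - 1| * (2 * omega * beta / (1 - r) ^+ 3)
               + `|alpha - 1| * alpha * beta * (1 + r) in
     let bound := Num.min (r * omega^-1) (delta * (b1 + b2)^-1) in
     (forall s, jump_at E 0 s -> bound <= s) /\
     (forall j s s', jump_at E j s -> jump_at E j.+1 s' -> bound <= s' - s)) /\
  (forall (E : nat -> set R) (phi : nat -> R -> 'rV[R]_n * 'rV[R]_n),
     hybrid_solution_II f alpha beta ulo uhi E phi -> zeno_free E).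
Proof.
(* Positivity of [beta] is read off [alpha_le]. *)
have beta_gt0 : 0 < beta.
  have : 0 < 2 * muf * beta by exact: lt_le_trans alpha_le.
  by rewrite pmulr_rgt0// mulr_gt0.
have beta_ge0 := ltW beta_gt0; have alpha_ge0 := ltW alpha_gt0.
have hess_bd x v : - lf * dotv v v <= dotv (v *m hess f x) v <= Lf * dotv v v.
  by have [h1 h2] := hess_bounds x; exact: loewner_hess_bounds.
split=> [E phi x10 sol start r r01 delta U cLf omega b1 b2 bound|E phi sol].
  split=> [s|j s s'].
    exact: (first_jump_ge alpha_ge0 beta_ge0 lf_ge0 Lf_ge0 ulo_lt uhi_gt f_smooth
      hess_bd sol r01 start).
  exact: (consecutive_jumps_ge alpha_ge0 beta_ge0 lf_ge0 Lf_ge0 ulo_lt uhi_gt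
    f_smooth hess_bd sol r01).
(* The bound degenerates to [0] when [lf = Lf = 0], since then [omega^-1 = 0];
   enlarging [Lf] slightly keeps the hypotheses and makes it positive. *)
pose gap := (uhi - (Lf * beta ^+ 2 + (1 - alpha) * beta)) / (2 * beta ^+ 2).
have gap_gt0 : 0 < gap by rewrite divr_gt0 ?subr_gt0 ?mulr_gt0 ?exprn_gt0.
have Lf'_gt0 : 0 < Lf + gap by exact: ltr_wpDl.
have uhi_gt' : (Lf + gap) * beta ^+ 2 + (1 - alpha) * beta < uhi.
  have : gap * beta ^+ 2 = (uhi - (Lf * beta ^+ 2 + (1 - alpha) * beta)) / 2.
    by rewrite /gap; field; rewrite gt_eqF.
  by rewrite mulrDl; lra.
have hess_bd' x v : - lf * dotv v v <= dotv (v *m hess f x) v <=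
    (Lf + gap) * dotv v v.
  have /andP[-> /le_trans->//] := hess_bd x v.
  by rewrite ler_wpM2r ?dotv_ge0// lerDl ltW.
have half01 : 0 < (2^-1 : R) < 1 by apply/andP; split; lra.
apply: (jumps_zeno_free sol (dwell_bound_gt0 alpha_ge0 beta_ge0 lf_ge0
  (ltW Lf'_gt0) ulo_lt uhi_gt' beta_gt0 Lf'_gt0 half01)) => j s s'.
exact: (consecutive_jumps_ge alpha_ge0 beta_ge0 lf_ge0 (ltW Lf'_gt0) ulo_lt
  uhi_gt' f_smooth hess_bd' sol half01).
Qed.
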